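(* Let $(V,\Omega)$ be a symplectic vector space with canonical Liouville form $\theta$, given by $\theta_z(v_z)=\frac12\Omega(z,v)$ for $z,v\in V$. For $a\in V$ and a positive integer $d$ let $\psi^{a,d}(z)=\frac{1}{2d}\Omega(a,z)^d$. Consider the following three families of Liouville structures on $V$: (A) all $(V,\theta+{\rm d}\psi^{a,2})$ with $a\in V\setminus\{0\}$; (B) all $(V,\theta+{\rm d}\psi^{a,d})$ with $a\in V$ and $d=1$ or $d\geq 3$ (this family contains the canonical structure $(V,\theta)$, obtained for $a=0$); (C) all $(V,\theta-{\rm d}\psi^{a,2})$ with $a\in V\setminus\{0\}$. Then any two Liouville structures in the same family are isomorphic, and no Liouville structure in one of these families is isomorphic to a Liouville structure in another of these families.
   Context: A symplectic vector space $(V,\Omega)$ is a finite-dimensional real vector space $V$ with a nonsingular alternating bilinear form $\Omega$. Regard $V$ as a smooth manifold; for $z,v\in V$ let $v_z\in T_zV$ be the tangent vector given by $v_z\psi=\frac{\rm d}{{\rm d}t}\psi(z+tv)|_{t=0}$ for smooth $\psi:V\to\mathbb{R}$. The symplectic form $\omega$ on the manifold $V$ is defined by $\omega_z(x_z,y_z)=\Omega(x,y)$; a Liouville structure on $V$ is a smooth one-form $\alpha$ with ${\rm d}\alpha=\omega$. An isomorphism from $(V,\alpha)$ to $(V,\beta)$ is a diffeomorphism $g:V\to V$ with $g^*\beta=\alpha$; two Liouville structures are isomorphic if such a $g$ exists. *)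

(* Defs.v *)
From HB Require Import structures.
From mathcomp Require Import all_boot all_order all_algebra.
From mathcomp Require Import all_classical all_reals all_analysis.

Set Implicit Arguments.
Unset Strict Implicit.
Unset Printing Implicit Defensive.

Import Order.TTheory GRing.Theory Num.Theory.
Import numFieldNormedType.Exports.

Local Open Scope classical_set_scope.
Local Open Scope ring_scope.

(** ** Smooth maps on a finite-dimensional real vector space *)

(* A function on R^m whose directional derivatives of order at most k exist and
   are continuous. *)
Fixpoint Ck (R : realType) (m : nat) (F : normedModType R) (k : nat)
    (f : 'rV[R]_m -> F) : Prop :=
  match k with
  | 0 => continuous f
  | k'.+1 => (forall x, differentiable f x) /\ (forall v, Ck k' ('D_v f))
  end.

(* [V : vectType R] carries no topology in the library: its smooth structure is
   the one of the global linear chart given by a basis.  Changing the basis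
   composes with a linear automorphism of R^n, so the choice is irrelevant. *)
Definition to_coords (R : realType) (V : vectType R) :
    V -> 'rV[R]_(\dim {:V}) := passmx.rVof (vbasis {:V}).

Definition of_coords (R : realType) (V : vectType R) :
    'rV[R]_(\dim {:V}) -> V := passmx.vecof (vbasis {:V}).

Definition smooth (R : realType) (V : vectType R) (F : normedModType R)
    (f : V -> F) : Prop :=
  forall k, Ck k (f \o @of_coords R V).

Definition smooth_map (R : realType) (V : vectType R) (g : V -> V) : Prop :=
  smooth (@to_coords R V \o g).

Definition diffeomorphism (R : realType) (V : vectType R) (g : V -> V) : Prop :=
  exists h : V -> V,
    [/\ cancel g h, cancel h g, smooth_map g & smooth_map h].

(** ** Tangent vectors and differential forms *)

(* The action of v_z on f; also used for vector-valued f. *)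
Definition tangent (R : realType) (V : vectType R) (F : normedModType R)
    (z v : V) (f : V -> F) : F :=
  derive1 (fun t : R => f (z + t *: v)) 0.

(* [tangent_map g z v] is the w in V such that T_z g sends v_z to w_(g z). *)
Definition tangent_map (R : realType) (V : vectType R) (g : V -> V) (z v : V) :
    V :=
  of_coords (tangent z v (@to_coords R V \o g)).

(* One- and two-forms are functions of the base point z and of vectors of V,
   through the identification of T_z V with V by v |-> v_z. *)
Definition smooth_one_form (R : realType) (V : vectType R) (alpha : V -> V -> R) :
    Prop :=
  (forall z, linear_for *%R (alpha z)) /\ (forall v, smooth (alpha ^~ v)).

Definition differential (R : realType) (V : vectType R) (psi : V -> R) :
    V -> V -> R :=
  fun z v => tangent z v psi.

(* d alpha (X, Y) = X (alpha Y) - Y (alpha X) - alpha [X, Y] evaluated on the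
   constant vector fields X = x, Y = y, whose bracket vanishes. *)
Definition exterior_derivative (R : realType) (V : vectType R)
    (alpha : V -> V -> R) : V -> V -> V -> R :=
  fun z x y => tangent z x (alpha ^~ y) - tangent z y (alpha ^~ x).

Definition pullback (R : realType) (V : vectType R) (g : V -> V)
    (beta : V -> V -> R) : V -> V -> R :=
  fun z v => beta (g z) (tangent_map g z v).

(** ** Symplectic vector spaces and Liouville structures *)

Definition symplectic (R : realType) (V : vectType R) (Omega : {biscalar V}) :
    Prop :=
  (forall v, Omega v v = 0) /\
  (forall v, (forall w, Omega v w = 0) -> v = 0).

Definition symplectic_two_form (R : realType) (V : vectType R)
    (Omega : {biscalar V}) : V -> V -> V -> R :=
  fun z x y => Omega x y.

Definition liouville (R : realType) (V : vectType R) (Omega : {biscalar V})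
    (alpha : V -> V -> R) : Prop :=
  smooth_one_form alpha /\
  exterior_derivative alpha = symplectic_two_form Omega.

Definition isomorphic (R : realType) (V : vectType R) (alpha beta : V -> V -> R) :
    Prop :=
  exists g : V -> V, diffeomorphism g /\ pullback g beta = alpha.

(** ** The three families *)

Definition canonical_form (R : realType) (V : vectType R)
    (Omega : {biscalar V}) : V -> V -> R :=
  fun z v => 2^-1 * Omega z v.

Definition psi (R : realType) (V : vectType R) (Omega : {biscalar V})
    (a : V) (d : nat) : V -> R :=
  fun z => (2 * d)%:R^-1 * Omega a z ^+ d.

Variant family_name := FamilyA | FamilyB | FamilyC.

Definition liouville_family (R : realType) (V : vectType R) (Omega : {biscalar V})
    (i : family_name) : set (V -> V -> R) :=
  let theta := canonical_form Omega in
  match i with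
  | FamilyA => [set alpha | exists a : V, a != 0 /\
      alpha = theta + differential (psi Omega a 2)]
  | FamilyB => [set alpha | exists (a : V) (d : nat), (d = 1 \/ 3 <= d)%N /\
      alpha = theta + differential (psi Omega a d)]
  | FamilyC => [set alpha | exists a : V, a != 0 /\
      alpha = theta - differential (psi Omega a 2)]
  end.

(* Main.v *)
From HB Require Import structures.
Require Import Defs.
From mathcomp Require Import all_boot all_order all_algebra.
From mathcomp Require Import all_classical all_reals all_analysis.
From mathcomp Require Import ring lra.

Set Implicit Arguments.
Unset Strict Implicit.
Unset Printing Implicit Defensive.

Import Order.TTheory GRing.Theory Num.Theory.
Import numFieldNormedType.Exports.

Local Open Scope classical_set_scope.
Local Open Scope ring_scope.

(** Up to the factor 1/2, every one-form of the three families is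
      z, v |-> Omega z v + e * Omega a z ^+ n * Omega a v
    with [n = d - 1] and [e] equal to 1 or -1 ([power_form]); the canonical form
    is the case [e = 0], with any [a] and [n].  The linear part of such a form in
    z is a bilinear form whose skew part is Omega, and only when [n = 1] does the
    extra term contribute to it, through its symmetric part.

    When [n != 1] the extra term can be removed: the
    shear z |-> z + c * Omega a z ^+ n *: a pulls the canonical form back to itself
    plus a multiple of the extra term containing the factor 1 - n
    ([power_form_canonical]).  When
    [n = 1], linear symplectic maps carry the form of [a] to that of any other
    nonzero vector, because transvections act transitively on nonzero vectors
    ([power_form_transitive]).  Transvections are again shears, with exponent 1.

    These reductions leave three kinds of forms, each of them a bilinear form
    evaluated at z and v that vanishes only at z = 0.  An isomorphism g
    therefore fixes 0, and differentiating the relation between the two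
    forms at 0 shows that the tangent map of g at 0 transports one bilinear form
    to the other ([pullback_bilinear]).  Restricting to the diagonal leaves
    the quadratic forms e * Omega a x ^+ 2, whose sign is then an invariant
    ([power_form_sign]): positive, zero or negative for the families A, B and C.

    Isomorphism is an equivalence relation, which allows these steps to be
    composed ([isomorphic_sym], [isomorphic_trans]); this rests on the
    stability of smoothness under composition ([Ck_comp]) and on the chain
    rule for tangent maps ([tangent_map_comp]). *)

(** * Calculus of functions of class Ck *)

Section CkTheory.
Context {R : realType}.

Lemma Ck_succ m (F : normedModType R) k (f : 'rV[R]_m -> F) :
  Ck k.+1 f -> Ck k f.
Proof.
elim: k f => [|k IH] f /= [df Df]; first by move=> x; exact: differentiable_continuous.
by split=> // v; apply: IH.
Qed.

Lemma Ck_cst m (F : normedModType R) k (c : F) : Ck k (cst c : 'rV[R]_m -> F).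
Proof.
elim: k c => [|k IH] c /=; first exact: cst_continuous.
split=> [x|v]; first exact: differentiable_cst.
rewrite (_ : 'D_v _ = cst 0); first exact: IH.
by apply/funext => x; rewrite derive_cst.
Qed.

Lemma CkD m (F : normedModType R) k (f g : 'rV[R]_m -> F) :
  Ck k f -> Ck k g -> Ck k (f + g).
Proof.
elim: k f g => [|k IH] f g /=.
  by move=> cf cg x; apply: continuousD; [exact: cf|exact: cg].
move=> [df Df] [dg Dg]; split=> [x|v]; first exact: differentiableD.
rewrite (_ : 'D_v _ = 'D_v f + 'D_v g); first exact: IH.
by apply/funext => x; rewrite deriveD//; exact: diff_derivable.
Qed.

Lemma CkM m k (f g : 'rV[R]_m -> R) : Ck k f -> Ck k g -> Ck k (f * g).
Proof.
elim: k f g => [|k IH] f g /=.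
  by move=> cf cg x; apply: continuousM; [exact: cf|exact: cg].
move=> Cf Cg; have [df Df] := Cf; have [dg Dg] := Cg.
split=> [x|v]; first exact: differentiableM.
rewrite (_ : 'D_v _ = f * 'D_v g + g * 'D_v f).
  by apply: CkD; apply: IH => //; exact: Ck_succ.
by apply/funext => x; rewrite deriveM//; exact: diff_derivable.
Qed.

Lemma Ck_sum m (F : normedModType R) k (I : Type) (r : seq I)
    (f : I -> 'rV[R]_m -> F) :
  (forall i, Ck k (f i)) -> Ck k (\sum_(i <- r) f i).
Proof.
move=> Cf; elim/big_ind: _ => [||i _]; first exact: Ck_cst.
- exact: CkD.
- exact: Cf.
Qed.

Lemma CkX m k (f : 'rV[R]_m -> R) n : Ck k f -> Ck k (f ^+ n).
Proof.
move=> Cf; elim: n => [|n IH]; first exact: Ck_cst.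
by rewrite exprS; exact: CkM.
Qed.

Lemma continuous_row (T : topologicalType) n (f : T -> 'rV[R]_n) :
  (forall i, continuous (fun x => f x 0 i)) -> continuous f.
Proof.
move=> cf x; apply/cvgrPdist_le => /= e e0; near=> y.
rewrite /Num.Def.normr/= mx_normrE (bigmax_le _ (ltW e0))//= => -[i j] _.
rewrite !mxE/= (ord1 i) => {i}; move: j; near: y; apply: filter_forall => j.
by move: (cf j x) => /cvgrPdist_le; apply.
Unshelve. all: by end_near. Qed.

Lemma differentiable_row (W : normedModType R) n (f : W -> 'rV[R]_n) x :
  (forall i, differentiable (fun x => f x 0 i) x) -> differentiable f x.
Proof.
move=> df; rewrite (_ : f = \sum_(i < n) (fun x => f x 0 i *: delta_mx 0 i)).
  by apply: differentiable_sum => i; exact: differentiableZl.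
by apply/funext => y; rewrite fct_sumE -row_sum_delta.
Qed.

Lemma derive_coord (W : normedModType R) n (f : W -> 'rV[R]_n) x v i :
  derivable f x v -> ('D_v f x) 0 i = 'D_v (fun y => f y 0 i) x.
Proof. by move=> df; rewrite derive_mx// mxE. Qed.

Lemma Ck_row m n k (f : 'rV[R]_m -> 'rV[R]_n) :
  (forall i, Ck k (fun x => f x 0 i)) <-> Ck k f.
Proof.
elim: k f => [|k IH] f /=.
  split=> [|cf i x]; first exact: continuous_row.
  by apply: (@continuous_comp _ _ _ f (fun y : 'rV[R]_n => y 0 i)); [exact: cf|exact: coord_continuous].
have DE v i : (forall x, differentiable f x) ->
    (fun x => 'D_v f x 0 i) = 'D_v (fun x => f x 0 i).
  by move=> df; apply/funext => x; rewrite derive_coord//; exact: diff_derivable.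
split=> [Cf|[df Df] i].
  have df x : differentiable f x.
    by apply: differentiable_row => i; have [] := Cf i.
  by split=> // v; apply/IH => i; rewrite DE//; have [_] := Cf i; apply.
split=> [x|v]; last by have /IH/(_ i) := Df v; rewrite DE.
by apply: (@differentiable_comp _ _ _ _ f (fun y : 'rV[R]_n => y 0 i));
  [exact: df|exact: differentiable_coord].
Qed.

Lemma Ck_id m k : Ck k (@id 'rV[R]_m).
Proof.
elim: k => [|k IH] /=; first by move=> x.
split=> // v; rewrite (_ : 'D_v _ = cst v); first exact: Ck_cst.
by apply/funext => x; rewrite derive_id.
Qed.

(** Written with the partial derivatives of [f], the right-hand side consists of
    sums and products of functions with one derivative less and of composites with
    [g]: this is what drives the induction in [Ck_comp]. *)
Lemma derive_comp m n (f : 'rV[R]_n -> R) (g : 'rV[R]_m -> 'rV[R]_n) x v :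
  differentiable g x -> differentiable f (g x) ->
  'D_v (f \o g) x =
    \sum_(i < n) 'D_v (fun y => g y 0 i) x * 'D_(delta_mx 0 i) f (g x).
Proof.
move=> dg df; rewrite deriveE; last exact: differentiable_comp.
rewrite diff_comp//= -[X in 'd f _ X]deriveE//.
rewrite [X in 'd f _ X]row_sum_delta linear_sum; apply: eq_bigr => i _.
by rewrite linearZ -deriveE// derive_coord//; exact: diff_derivable.
Qed.

Lemma Ck_comp m n k (f : 'rV[R]_n -> R) (g : 'rV[R]_m -> 'rV[R]_n) :
  Ck k f -> Ck k g -> Ck k (f \o g).
Proof.
elim: k f g => [|k IH] f g.
  by move=> cf cg x; apply: continuous_comp; [exact: cg|exact: cf].
move=> Cf Cg; have [df Df] := Cf; have [dg Dg] := Cg.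
split=> [x|v]; first exact: differentiable_comp.
rewrite (_ : 'D_v _ = \sum_(i < n)
    (fun x => 'D_v (fun y => g y 0 i) x) * ('D_(delta_mx 0 i) f \o g)).
  apply: Ck_sum => i; apply: CkM.
    by have /Ck_row/(_ i)/=[_ Dgi] := Cg; exact: Dgi.
  exact: IH (Df _) (Ck_succ Cg).
by apply/funext => x; rewrite derive_comp// fct_sumE.
Qed.

End CkTheory.

(** * Smooth maps, tangent maps and isomorphisms *)

Section SmoothTheory.
Context {R : realType} {V : vectType R}.
Local Notation n := (\dim {:V}).
Implicit Types (z v : V).

Lemma to_coordsK : cancel (@to_coords R V) (@of_coords R V).
Proof. exact/passmx.rVofK/vbasisP. Qed.

Lemma of_coordsK : cancel (@of_coords R V) (@to_coords R V).
Proof. exact/passmx.vecofK/vbasisP. Qed.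

HB.instance Definition _ :=
  GRing.isLinear.Build R V 'rV[R]_n *:%R (@to_coords R V)
    (passmx.rVof_linear (vbasis {:V})).
HB.instance Definition _ :=
  GRing.isLinear.Build R 'rV[R]_n V *:%R (@of_coords R V)
    (passmx.vecof_linear (vbasis {:V})).

Lemma smooth_cst (F : normedModType R) (c : F) : smooth (cst c : V -> F).
Proof. by move=> k; exact: Ck_cst. Qed.

Lemma smoothD (F : normedModType R) (f g : V -> F) :
  smooth f -> smooth g -> smooth (f + g).
Proof. by move=> sf sg k; exact: CkD (sf k) (sg k). Qed.

Lemma smoothM (f g : V -> R) : smooth f -> smooth g -> smooth (f * g).
Proof. by move=> sf sg k; exact: CkM (sf k) (sg k). Qed.

Lemma smoothX (f : V -> R) m : smooth f -> smooth (f ^+ m).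
Proof.
move=> sf k; have := CkX m (sf k); congr (Ck k _); apply/funext => x.
by rewrite /= !exprfctE.
Qed.

Lemma linear_formP (f : V -> R) : linear_for *%R f ->
  [/\ f 0 = 0, {morph f : x y / x + y} & scalable_for *%R f].
Proof.
move=> lf; pose g : {linear V -> R^o} := HB.pack f
  (GRing.isLinear.Build R V R^o _ f lf).
split; [exact: (linear0 g)|exact: (linearD g)|exact: (linearZ_LR g)].
Qed.

Lemma linear_formE (f : V -> R) x : linear_for *%R f ->
  f (of_coords x) = \sum_(i < n) x 0 i * f (of_coords (delta_mx 0 i)).
Proof.
move=> lf; pose g : {linear V -> R^o} := HB.pack f
  (GRing.isLinear.Build R V R^o _ f lf).
rewrite {1}[x]row_sum_delta linear_sum -[LHS]/(g _) linear_sum.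
by apply: eq_bigr => i _; rewrite !linearZ.
Qed.

Lemma smooth_linear (f : V -> R) : linear_for *%R f -> smooth f.
Proof.
move=> lf k; rewrite (_ : _ \o _ = \sum_(i < n) ((fun x : 'rV[R]_n => x 0 i) *
    cst (f (of_coords (delta_mx 0 i))))).
  apply: Ck_sum => i; apply: CkM; last exact: Ck_cst.
  by move: i; apply/Ck_row; exact: Ck_id.
by apply/funext => x; rewrite /= linear_formE// fct_sumE.
Qed.

Lemma smooth_differentiable (F : normedModType R) (f : V -> F) x :
  smooth f -> differentiable (f \o @of_coords R V) x.
Proof. by move=> /(_ 1)[]. Qed.

Lemma smooth_mapP (g : V -> V) :
  smooth_map g <-> forall i, smooth (fun z => to_coords (g z) 0 i).
Proof.
split=> [sg i k|sg k]; first by have /Ck_row/(_ i) := sg k.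
by apply/Ck_row => i; exact: sg.
Qed.

Lemma smooth_map_comp (g h : V -> V) :
  smooth_map g -> smooth_map h -> smooth_map (h \o g).
Proof.
move=> sg /smooth_mapP sh; apply/smooth_mapP => i k.
have := Ck_comp (sh i k) (sg k); congr (Ck k _).
by apply/funext => x /=; rewrite to_coordsK.
Qed.

(** Reduces tangent vectors of V to directional derivatives in the chart, where the
    differentials and the chain rule are available. *)
Lemma tangentE (F : normedModType R) (f : V -> F) z v :
  tangent z v f = 'D_(to_coords v) (f \o @of_coords R V) (to_coords z).
Proof.
rewrite /tangent /derive1 /derive.
set c := (fun _ : R => _); set c' := (fun _ : R => _).
suff -> : c = c' by []; apply/funext => h; rewrite /c /c'.
rewrite /= addr0 scale0r addr0 to_coordsK; congr (_ *: (f _ - _)).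
have E x y : of_coords (h *: x + y) = h *: of_coords x + of_coords y :> V.
  exact: linearP.
by apply/esym; rewrite [LHS]E !to_coordsK addrC.
Qed.

Lemma tangent_mapE (g : V -> V) z v :
  to_coords (tangent_map g z v) =
  'D_(to_coords v) (@to_coords R V \o g \o @of_coords R V) (to_coords z).
Proof. by rewrite /tangent_map tangentE of_coordsK. Qed.

Lemma tangent_map_comp (g h : V -> V) z v : smooth_map g -> smooth_map h ->
  tangent_map (h \o g) z v = tangent_map h (g z) (tangent_map g z v).
Proof.
move=> sg sh; apply: (can_inj to_coordsK).
rewrite tangent_mapE [RHS]tangent_mapE.
rewrite tangent_mapE.
set G := @to_coords R V \o g \o _; set H := @to_coords R V \o h \o _.
have -> : @to_coords R V \o (h \o g) \o @of_coords R V = H \o G.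
  by apply/funext => x; rewrite /H /G /= to_coordsK.
have dG x : differentiable G x by exact: smooth_differentiable sg.
have dH x : differentiable H x by exact: smooth_differentiable sh.
have HG x w : 'D_w (H \o G) x = 'D_('D_w G x) H (G x).
  rewrite deriveE; last exact: differentiable_comp.
  by rewrite diff_comp// [RHS]deriveE// deriveE.
by rewrite HG /G /= to_coordsK.
Qed.

Lemma tangent_curve (F : normedModType R) (f : V -> F) z v (c : R -> F) d :
  (forall t, f (z + t *: v) = c t) -> is_derive (0 : R) 1 c d ->
  tangent z v f = d.
Proof.
move=> fc dc; rewrite /tangent (_ : (fun t => _) = c); last exact/funext.
by rewrite derive1E; exact: derive_val.
Qed.

Lemma tangent_map_curve (g : V -> V) z v (c : R -> R) d (a0 a1 u : V) :
  (forall t, g (z + t *: v) = a0 + t *: a1 + c t *: u) ->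
  is_derive (0 : R) 1 c d -> tangent_map g z v = a1 + d *: u.
Proof.
move=> gc dc; rewrite /tangent_map.
have dZ (e : R -> R) de (w : 'rV[R]_n) : is_derive (0 : R) 1 e de ->
    is_derive (0 : R) 1 (fun t => e t *: w) (de *: w).
  move=> he; have de0 : differentiable e 0 by apply/derivable1_diffP.
  apply: DeriveDef; first exact/diff_derivable/differentiableZl.
  rewrite deriveE; last exact: differentiableZl.
  by rewrite diffZl// -deriveE//; congr (_ *: _); exact: derive_val.
have d0 := is_derive_cst (to_coords a0) (0 : R) 1.
have d1 := dZ _ _ (to_coords a1) (is_derive_id (0 : R) (1 : R)).
pose C := cst (to_coords a0) + (fun t => t *: to_coords a1) +
  (fun t => c t *: to_coords u).
have gC t : (@to_coords R V \o g) (z + t *: v) = C t.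
  by rewrite /C /= gc !linearD !linearZ.
have dC : is_derive (0 : R) 1 C (0 + 1 *: to_coords a1 + d *: to_coords u).
  exact: is_deriveD (is_deriveD d0 d1) (dZ _ _ _ dc).
have -> := tangent_curve gC dC.
by rewrite add0r scale1r linearD linearZ /= !to_coordsK.
Qed.

Lemma smooth_map_id : smooth_map (@id V).
Proof.
by apply/smooth_mapP => i; apply: smooth_linear => a x y; rewrite linearP !mxE.
Qed.

Lemma tangent_map_id z v : tangent_map id z v = v.
Proof.
rewrite (@tangent_map_curve _ _ _ (cst 0) 0 z v 0) ?scaler0 ?addr0//.
by move=> t; rewrite scaler0 addr0.
Qed.

Lemma tangent_map_cancel (g h : V -> V) z v : smooth_map g -> smooth_map h ->
  cancel g h -> tangent_map h (g z) (tangent_map g z v) = v.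
Proof.
move=> sg sh gK; rewrite -tangent_map_comp// (_ : h \o g = id).
  exact: tangent_map_id.
exact/funext.
Qed.

Lemma isomorphic_refl (alpha : V -> V -> R) : isomorphic alpha alpha.
Proof.
exists id; split; first by exists id; split=> //; exact: smooth_map_id.
by apply/funext => z; apply/funext => v; rewrite /pullback tangent_map_id.
Qed.

Lemma isomorphic_sym (alpha beta : V -> V -> R) :
  isomorphic alpha beta -> isomorphic beta alpha.
Proof.
move=> [g [[h [gK hK sg sh]] <-]]; exists h; split; first by exists g.
apply/funext => z; apply/funext => v; rewrite /pullback hK.
by have := tangent_map_cancel z v sh sg hK => ->.
Qed.

Lemma isomorphic_trans (beta alpha gamma : V -> V -> R) :
  isomorphic alpha beta -> isomorphic beta gamma -> isomorphic alpha gamma.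
Proof.
move=> [g [[g' [gK g'K sg sg']] <-]] [h [[h' [hK h'K sh sh']] <-]].
exists (h \o g); split.
  exists (g' \o h'); split; [exact: can_comp|exact: can_comp| |];
    exact: smooth_map_comp.
by apply/funext => z; apply/funext => v; rewrite /pullback tangent_map_comp.
Qed.

(** Since [A] is homogeneous in the base point, [A x v] is [A (t *: x) v] divided
    by t for every t != 0, hence equal to
    [B (t^-1 *: g (t *: x)) (tangent_map g (t *: x) v)].  As t tends to 0, the first
    argument tends to [tangent_map g 0 x] because [g 0 = 0], and the second one to
    [tangent_map g 0 v] because [g] is continuously differentiable. *)
Lemma pullback_bilinear (A B : V -> V -> R) (g : V -> V) x v :
  (forall t, A (t *: x) v = t * A x v) ->
  (forall w, linear_for *%R (B^~ w)) -> (forall w, linear_for *%R (B w)) ->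
  smooth_map g -> g 0 = 0 -> pullback g B = A ->
  B (tangent_map g 0 x) (tangent_map g 0 v) = A x v.
Proof.
move=> A1 Bl Br sg g0 gBA.
pose G := @to_coords R V \o g \o @of_coords R V.
have G0 : G 0 = 0 by rewrite /G /= linear0 g0 linear0.
pose b := fun i j : 'I_n => B (of_coords (delta_mx 0 i)) (of_coords (delta_mx 0 j)).
have BE X Y : B (of_coords X) (of_coords Y) =
    \sum_i \sum_j X 0 i * (Y 0 j * b i j).
  rewrite (linear_formE X (Bl _)); apply: eq_bigr => i _.
  by rewrite (linear_formE Y (Br _)) mulr_sumr.
pose DG (t : R) := 'D_(to_coords v) G (t *: to_coords x).
pose Q (t : R) := t^-1 *: G (t *: to_coords x).
have limDG : DG t @[t --> 0^'] --> DG 0.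
  apply: (@cvg_trans _ (DG t @[t --> (0 : R)])).
    by move=> S; exact: nbhs_dnbhs.
  have [_ /(_ (to_coords v))/= cDG] := sg 1%N.
  apply: (@continuous_comp _ _ _ (fun t : R => t *: to_coords x)
    ('D_(to_coords v) G)); last exact: cDG.
  exact: scalel_continuous.
have limQ : Q t @[t --> 0^'] --> 'D_(to_coords x) G 0.
  have dG : derivable G 0 (to_coords x).
    by apply: diff_derivable; exact: smooth_differentiable sg.
  rewrite (_ : Q = fun t => t^-1 *: ((G \o shift 0) (t *: to_coords x) - G 0)).
    exact: dG.
  by apply/funext => t; rewrite /Q /= addr0 G0 subr0.
have limB : (B (of_coords (Q t)) (of_coords (DG t))) @[t --> 0^'] -->
    B (of_coords ('D_(to_coords x) G 0)) (of_coords (DG 0)).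
  rewrite BE; under eq_fun do rewrite BE.
  have coord (F : R -> 'rV[R]_n) (l : 'rV[R]_n) i :
      F t @[t --> 0^'] --> l -> F t 0 i @[t --> 0^'] --> l 0 i.
    move=> Fl; exact: (cvg_comp F (fun y : 'rV[R]_n => y 0 i) Fl
      (@coord_continuous _ _ _ 0 i l)).
  apply: cvg_big; [exact: add_continuous|move=> i _].
  apply: cvg_big; [exact: add_continuous|move=> j _].
  exact: cvgM (coord _ _ i limQ) (cvgM (coord _ _ j limDG) (cvg_cst (b i j))).
have limA : (B (of_coords (Q t)) (of_coords (DG t))) @[t --> 0^'] --> A x v.
  apply: cvg_near_cst; near=> t.
  have t0 : t != 0 by near: t; exact: nbhs_dnbhs_neq.
  have toZ (y : V) : t *: to_coords y = to_coords (t *: y) by rewrite linearZ.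
  have -> : of_coords (DG t) = tangent_map g (t *: x) v.
    by rewrite /tangent_map tangentE /DG toZ.
  have -> : of_coords (Q t) = t^-1 *: g (t *: x).
    by rewrite /Q toZ linearZ /G /= !to_coordsK.
  have [_ _ ->] := linear_formP (Bl (tangent_map g (t *: x) v)).
  by rewrite -[B _ _]/(pullback g B _ _) gBA A1 mulKf.
have := cvg_unique _ limB limA.
rewrite /DG scale0r /tangent_map !tangentE linear0; exact.
Unshelve. all: by end_near. Qed.

End SmoothTheory.

(** * Isomorphisms between the forms of each family *)

Section LiouvilleForms.
Context {R : realType} {V : vectType R} (Omega : {biscalar V}).
Hypothesis hOmega : symplectic Omega.
Implicit Types (a b u z v w : V) (c e : R) (n : nat).

Lemma OmegaDl z x y : Omega (x + y) z = Omega x z + Omega y z.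
Proof. exact: linearDl. Qed.
Lemma OmegaDr z x y : Omega z (x + y) = Omega z x + Omega z y.
Proof. exact: linearDr. Qed.
Lemma OmegaZl z c x : Omega (c *: x) z = c * Omega x z.
Proof. exact: linearZl_LR. Qed.
Lemma OmegaZr z c x : Omega z (c *: x) = c * Omega z x.
Proof. exact: linearZr_LR. Qed.
Lemma Omega0l z : Omega 0 z = 0.
Proof. exact: linear0l. Qed.
Lemma Omega_alt x : Omega x x = 0.
Proof. exact: hOmega.1. Qed.

Lemma OmegaC x y : Omega x y = - Omega y x.
Proof.
apply/eqP; rewrite -addr_eq0; apply/eqP.
by have := Omega_alt (x + y); rewrite OmegaDl !OmegaDr !Omega_alt addr0 add0r.
Qed.

Lemma Omega_linear z : linear_for *%R (Omega z).
Proof. by move=> a x y; rewrite OmegaDr OmegaZr. Qed.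

Lemma Omega_neq0 a : a != 0 -> exists x, Omega a x != 0.
Proof.
move=> a0; apply: contrapT => H; move/eqP: a0; apply; apply: hOmega.2 => x.
by apply: contrapT => /eqP ax; apply: H; exists x.
Qed.

(** Twice this form is the contraction of Omega with the vector field
    z |-> z + (e * Omega a z ^+ n) *: a.  The coefficient [e] treats both signs
    and the canonical form ([e = 0]) together. *)
Definition power_form e a n : V -> V -> R :=
  fun z v => 2^-1 * (Omega z v + e * Omega a z ^+ n * Omega a v).

Lemma Omega_line_derive a z v n : is_derive (0 : R) 1
  (fun t => Omega a (z + t *: v) ^+ n) (n%:R * Omega a z ^+ n.-1 * Omega a v).
Proof.
pose f t := Omega a z + t * Omega a v.
have -> : (fun t => Omega a (z + t *: v) ^+ n) = f ^+ n.
  by apply/funext => t; rewrite exprfctE /f OmegaDr OmegaZr.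
have df : is_derive (0 : R) 1 f (Omega a v).
  have := is_deriveD (is_derive_cst (Omega a z) (0 : R) 1)
    (is_deriveM (is_derive_id (0 : R) (1 : R)) (is_derive_cst (Omega a v) (0 : R) 1)).
  by rewrite scaler0 !add0r /cst [_ *: _]mulr1; exact.
have := is_deriveX n df.
by rewrite /f mul0r addr0; exact.
Qed.

Lemma differential_psi a n z v :
  differential (psi Omega a n.+1) z v = 2^-1 * Omega a z ^+ n * Omega a v.
Proof.
pose k : R := (2 * n.+1)%:R^-1.
have dk := is_deriveZ k (Omega_line_derive a z v n.+1).
rewrite /differential (tangent_curve (fun=> erefl) dk) /k.
by rewrite natrM invfM [LHS]mulrA mulrA mulfVK ?pnatr_eq0.
Qed.

Lemma canonical_formE : canonical_form Omega = power_form 0 0 1.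
Proof.
apply/funext => z; apply/funext => v.
by rewrite /power_form !mul0r addr0.
Qed.

Lemma add_differential_psiE a n :
  canonical_form Omega + differential (psi Omega a n.+1) = power_form 1 a n.
Proof.
apply/funext => z; apply/funext => v.
by rewrite /power_form mulrDr mul1r mulrA -differential_psi.
Qed.

Lemma sub_differential_psiE a n :
  canonical_form Omega - differential (psi Omega a n.+1) = power_form (- 1) a n.
Proof.
apply/funext => z; apply/funext => v.
by rewrite /power_form mulrDr mulN1r mulNr mulrN mulrA -differential_psi.
Qed.

Lemma smooth_Omega a : smooth (fun z => Omega a z).
Proof. exact/smooth_linear/Omega_linear. Qed.

Lemma power_form_liouville e a n : liouville Omega (power_form e a n).
Proof.
split.
  split=> [z k x y|v].
    by rewrite /power_form !OmegaDr !OmegaZr; ring.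
  have -> : (fun z => power_form e a n z v) =
      cst 2^-1 * (cst (- 1) * Omega v +
        cst (e * Omega a v) * (Omega a : V -> R) ^+ n).
    apply/funext => z; rewrite /power_form (OmegaC z v).
    transitivity (2^-1 * (- 1 * Omega v z +
        e * Omega a v * ((Omega a : V -> R) ^+ n) z)); last by [].
    by rewrite exprfctE; ring.
  apply: smoothM; first exact: smooth_cst.
  apply: smoothD; apply: smoothM; do ?exact: smooth_cst.
    exact: smooth_Omega.
  exact/smoothX/smooth_Omega.
have D z x y : tangent z x ((power_form e a n)^~ y) =
    2^-1 * (Omega x y + e * (n%:R * Omega a z ^+ n.-1 * Omega a x) * Omega a y).
  have d0 := is_derive_cst (2^-1 * Omega z y) (0 : R) 1.
  have d1 := is_deriveZ (2^-1 * Omega x y) (is_derive_id (0 : R) (1 : R)).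
  have d2 := is_deriveZ (2^-1 * e * Omega a y) (Omega_line_derive a z x n).
  rewrite (tangent_curve _ (is_deriveD (is_deriveD d0 d1) d2)).
    by rewrite /GRing.scale /=; ring.
  move=> t; rewrite /power_form OmegaDl OmegaZl.
  transitivity (2^-1 * Omega z y + 2^-1 * Omega x y * t +
    2^-1 * e * Omega a y * Omega a (z + t *: x) ^+ n); last by [].
  by ring.
apply/funext => z; apply/funext => x; apply/funext => y.
rewrite /exterior_derivative !D /symplectic_two_form (OmegaC y x).
by field.
Qed.

(** The flow at time [c] of the Hamiltonian vector field z |-> Omega u z ^+ n *: u,
    which preserves Omega u; it is a translation for [n = 0] and a symplectic
    transvection for [n = 1]. *)
Definition shear c u n : V -> V := fun z => z + (c * Omega u z ^+ n) *: u.

Lemma shearK c u n : cancel (shear c u n) (shear (- c) u n).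
Proof.
move=> z; rewrite /shear OmegaDr OmegaZr Omega_alt mulr0 addr0.
by rewrite mulNr scaleNr addrK.
Qed.

Lemma shear_smooth c u n : smooth_map (shear c u n).
Proof.
apply/smooth_mapP => i.
rewrite (_ : (fun z => _) = (fun z => to_coords z 0 i) +
    cst (c * to_coords u 0 i) * (Omega u : V -> R) ^+ n).
  apply: smoothD; first by move: i; apply/smooth_mapP; exact: smooth_map_id.
  by apply: smoothM; [exact: smooth_cst|exact/smoothX/smooth_Omega].
have coordP (A B : 'rV[R]_(\dim {:V})) k :
  (A + k *: B) 0 i = A 0 i + k * B 0 i by rewrite !mxE.
apply/funext => z; rewrite /shear linearD linearZ /= coordP.
transitivity (to_coords z 0 i + c * to_coords u 0 i *
    ((Omega u : V -> R) ^+ n) z); last by [].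
by rewrite exprfctE mulrAC.
Qed.

Lemma shear_diffeomorphism c u n : diffeomorphism (shear c u n).
Proof.
exists (shear (- c) u n); split; try exact: shear_smooth; first exact: shearK.
by have := shearK (- c) u n; rewrite opprK.
Qed.

Lemma tangent_shear c u n z v : tangent_map (shear c u n) z v =
  v + (c * (n%:R * Omega u z ^+ n.-1 * Omega u v)) *: u.
Proof.
apply: (@tangent_map_curve _ _ _ _ _ (c *: (fun t => Omega u (z + t *: v) ^+ n))
  _ z); last exact: is_deriveZ (Omega_line_derive _ _ _ _).
by [].
Qed.

(** Pulling the canonical form back by the shear of coefficient c adds
    c * (1 - n) / 2 times Omega a z ^+ n * Omega a v: the 1 comes from moving the
    base point, and the - n from moving the tangent vector. *)
Lemma power_form_canonical e a n : n != 1%N ->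
  isomorphic (power_form e a n) (canonical_form Omega).
Proof.
move=> n1; have n1R : 1 - n%:R != 0 :> R.
  by rewrite subr_eq0 eq_sym pnatr_eq1.
exists (shear (e / (1 - n%:R)) a n); split; first exact: shear_diffeomorphism.
apply/funext => z; apply/funext => v.
rewrite /pullback /canonical_form /power_form tangent_shear /shear.
rewrite OmegaDl !OmegaDr !OmegaZl !OmegaZr Omega_alt (OmegaC z a).
(* The exponent n.-1 of the tangent map has to be compared with n. *)
case: n n1 n1R => [|n] n1 n1R /=; first by field.
by rewrite exprS; field; rewrite nat1r.
Qed.

(** The transvection along b - a that maps [a] to [b] is linear and symplectic. *)
Lemma power_form_transvection e a b n : Omega a b != 0 ->
  isomorphic (power_form e a n) (power_form e b n).
Proof.
move=> ab0; pose u := b - a; exists (shear (Omega b a)^-1 u 1).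
have ba0 : Omega b a != 0 by rewrite OmegaC oppr_eq0.
split; first exact: shear_diffeomorphism.
have tE z v : tangent_map (shear (Omega b a)^-1 u 1) z v
    = shear (Omega b a)^-1 u 1 v.
  by rewrite tangent_shear /shear mul1r expr0 mul1r expr1.
have bE z : Omega b (shear (Omega b a)^-1 u 1 z) = Omega a z.
  rewrite /shear OmegaDr OmegaZr expr1.
  have -> : Omega b u = - Omega b a.
    by rewrite /u -scaleN1r OmegaDr OmegaZr Omega_alt mulN1r add0r.
  have -> : Omega u z = Omega b z - Omega a z.
    by rewrite /u -scaleN1r OmegaDl OmegaZl mulN1r.
  by field.
apply/funext => z; apply/funext => v.
rewrite /pullback /power_form tE !bE; congr (_ * (_ + _)).
rewrite /shear !expr1 OmegaDl !OmegaDr !OmegaZl !OmegaZr Omega_alt (OmegaC z u).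
by ring.
Qed.

(** If Omega a b = 0, two transvections are needed, through a vector that is
    orthogonal to neither [a] nor [b]. *)
Lemma power_form_transitive e a b n : a != 0 -> b != 0 ->
  isomorphic (power_form e a n) (power_form e b n).
Proof.
move=> a0 b0; have [ab0|ab0] := eqVneq (Omega a b) 0; last first.
  exact: power_form_transvection.
suff [w [aw bw]] : exists w, Omega a w != 0 /\ Omega b w != 0.
  apply: (isomorphic_trans (power_form_transvection e n aw)).
  by apply: power_form_transvection; rewrite OmegaC oppr_eq0.
have [x ax] := Omega_neq0 a0; have [y bY] := Omega_neq0 b0.
have [bx|bx] := eqVneq (Omega b x) 0; last by exists x.
have [ay|ay] := eqVneq (Omega a y) 0; last by exists y.
by exists (x + y); rewrite !OmegaDr bx ay addr0 add0r.
Qed.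

(** * The sign of the quadratic part as an invariant *)

(** Nondegeneracy gives z = - (e * Omega a z) *: a, and pairing this with [a]
    gives Omega a z = 0. *)
Lemma power_form_vanish e a z : (forall v, power_form e a 1 z v = 0) -> z = 0.
Proof.
move=> H; have zE : z + (e * Omega a z) *: a = 0.
  apply: hOmega.2 => v; rewrite OmegaDl OmegaZl.
  have /eqP := H v; rewrite /power_form expr1 mulf_eq0 invr_eq0 pnatr_eq0 /=.
  by move=> /eqP.
have : Omega a (z + (e * Omega a z) *: a) = Omega a 0 by rewrite zE.
rewrite OmegaDr OmegaZr Omega_alt mulr0 addr0 [RHS]OmegaC Omega0l oppr0 => az.
by move: zE; rewrite az mulr0 scale0r addr0.
Qed.

(** An isomorphism maps the only zero of one form to that of the other, so it fixes
    0 and [pullback_bilinear] applies; on the diagonal Omega disappears.  [L] is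
    the tangent map at 0. *)
Lemma power_form_quadratic e e' a b :
  isomorphic (power_form e a 1) (power_form e' b 1) ->
  exists L : V -> V, forall x, e' * Omega b (L x) ^+ 2 = e * Omega a x ^+ 2.
Proof.
move=> [g [[h [gK hK sg sh]] gE]].
have form0 c w v : power_form c w 1 0 v = 0.
  rewrite /power_form expr1 Omega0l (OmegaC w 0) Omega0l; ring.
have g0 : g 0 = 0.
  apply: (@power_form_vanish e' b) => w.
  have := tangent_map_cancel (g 0) w sh sg hK.
  rewrite gK => <-; rewrite -[LHS]/(pullback g _ _ _) gE; exact: form0.
exists (tangent_map g 0) => x.
have := @pullback_bilinear _ _ (power_form e a 1) (power_form e' b 1) g x x.
rewrite /power_form !Omega_alt !add0r => H.
have : 2^-1 * (e' * Omega b (tangent_map g 0 x) ^+ 1 *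
    Omega b (tangent_map g 0 x)) = 2^-1 * (e * Omega a x ^+ 1 * Omega a x).
  apply: H => //.
  - by move=> t; rewrite !OmegaZl !OmegaZr Omega_alt; ring.
  - by move=> w k y y'; rewrite !OmegaDl !OmegaZl !OmegaDr !OmegaZr; ring.
  - by move=> w k y y'; rewrite !OmegaDr !OmegaZr; ring.
by rewrite !expr2 !expr1 => H'; lra.
Qed.

Lemma power_form_sign e e' a b : (e != 0 -> a != 0) -> (e' != 0 -> b != 0) ->
  isomorphic (power_form e a 1) (power_form e' b 1) -> Num.sg e = Num.sg e'.
Proof.
have main (f f' : R) u w : f != 0 -> u != 0 ->
    isomorphic (power_form f u 1) (power_form f' w 1) -> Num.sg f = Num.sg f'.
  move=> f0 /Omega_neq0[x ux] /power_form_quadratic[L /(_ x) LE].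
  have ux2 : 0 < Omega u x ^+ 2 by rewrite exprn_even_gt0.
  have wL2 : 0 < Omega w (L x) ^+ 2.
    rewrite exprn_even_gt0//=; apply/negP => /eqP wL0.
    move: LE; rewrite wL0 expr0n mulr0 => /esym/eqP.
    by rewrite mulf_eq0 (negbTE f0) gt_eqF.
  have sgE (k X : R) : 0 < X -> Num.sg (k * X) = Num.sg k.
    by move=> X0; rewrite sgrM (gtr0_sg X0) mulr1.
  by rewrite -(sgE f _ ux2) -LE sgE.
have [->|e0] := eqVneq e 0; last by move=> a0 _; apply: main => //; exact: a0.
have [->//|e'0] := eqVneq e' 0.
by move=> _ b0 /isomorphic_sym iso; apply/esym/(main _ _ _ _ e'0 (b0 _) iso).
Qed.

(** For [e = 0] both forms are the canonical one. *)
Lemma power_form_isomorphic e a b : (e != 0 -> a != 0) -> (e != 0 -> b != 0) ->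
  isomorphic (power_form e a 1) (power_form e b 1).
Proof.
have [->|e0] := eqVneq e 0 => a0 b0.
  rewrite (_ : power_form 0 b 1 = power_form 0 a 1); first exact: isomorphic_refl.
  by apply/funext => z; apply/funext => v; rewrite /power_form !mul0r.
by apply: power_form_transitive; [exact: a0|exact: b0].
Qed.

(** The coefficient [e] of the forms with exponent 1 to which the members of the
    family are isomorphic. *)
Definition family_sign (i : family_name) : R :=
  match i with FamilyA => 1 | FamilyB => 0 | FamilyC => - 1 end.

Lemma family_sign_inj i j :
  Num.sg (family_sign i) = Num.sg (family_sign j) -> i = j.
Proof.
by case: i; case: j => //=; rewrite ?sgr0 ?sgr1 ?sgrN1 => H; exfalso; lra.
Qed.

(** Exponents other than 1 occur only in the family B, where they are all removed by
    passing to the canonical form. *)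
Lemma liouville_familyP i alpha : liouville_family Omega i alpha ->
  liouville Omega alpha /\
  exists a, (family_sign i != 0 -> a != 0) /\
    isomorphic alpha (power_form (family_sign i) a 1).
Proof.
case: i => /=.
- move=> [a [a0 ->]]; rewrite add_differential_psiE.
  by split; [exact: power_form_liouville|exists a; split=> //; exact: isomorphic_refl].
- move=> [a [[|n] [hd ->]]]; first by case: hd.
  rewrite add_differential_psiE; split; first exact: power_form_liouville.
  exists 0; split; [by rewrite eqxx|rewrite -canonical_formE].
  by apply: power_form_canonical; case: hd => [[->]|]; last by case: n => [|[]].
- move=> [a [a0 ->]]; rewrite sub_differential_psiE.
  by split; [exact: power_form_liouville|exists a; split=> //; exact: isomorphic_refl].
Qed.

Lemma canonical_form_familyB :
  liouville_family Omega FamilyB (canonical_form Omega).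
Proof.
exists 0, 1%N; split; first by left.
rewrite add_differential_psiE canonical_formE; apply/funext => z.
by apply/funext => v; rewrite /power_form !Omega0l !mulr0.
Qed.

End LiouvilleForms.

(** * Classification *)

Theorem mainTheorem10 (R : realType) (V : vectType R) (Omega : {biscalar V})
    (hOmega : symplectic Omega) :
  [/\ forall (i : family_name) (alpha : V -> V -> R),
        liouville_family Omega i alpha -> liouville Omega alpha,
      liouville_family Omega FamilyB (canonical_form Omega),
      forall (i : family_name) (alpha beta : V -> V -> R),
        liouville_family Omega i alpha -> liouville_family Omega i beta ->
        isomorphic alpha beta
    & forall (i j : family_name) (alpha beta : V -> V -> R),
        i <> j ->
        liouville_family Omega i alpha -> liouville_family Omega j beta ->
        ~ isomorphic alpha beta].
Proof.
split.
- by move=> i alpha /(liouville_familyP hOmega)[].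
- exact: canonical_form_familyB.
- move=> i alpha beta /(liouville_familyP hOmega)[_ [a [a0 ialpha]]].
  move=> /(liouville_familyP hOmega)[_ [b [b0 ibeta]]].
  apply: (isomorphic_trans ialpha); apply: isomorphic_trans (isomorphic_sym ibeta).
  exact: power_form_isomorphic.
- move=> i j alpha beta ij /(liouville_familyP hOmega)[_ [a [a0 ialpha]]].
  move=> /(liouville_familyP hOmega)[_ [b [b0 ibeta]]] iso.
  apply: ij; apply: (family_sign_inj (R := R)).
  apply: (power_form_sign hOmega a0 b0).
  exact: isomorphic_trans (isomorphic_sym ialpha) (isomorphic_trans iso ibeta).
Qed.
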